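(* For any prime $p\ge 5$, \[ \sum_{k=0}^{p-1}\frac{3k+2}{(-2)^k}\,\mathrm{Domb}(k)\equiv 2p(-1)^{\frac{p-1}{2}}+6p^3E_{p-3}\pmod{p^4}. \]
   Context: The Domb numbers are $\mathrm{Domb}(n)=\sum_{k=0}^n\binom{n}{k}^2\binom{2k}{k}\binom{2n-2k}{n-k}$. The Euler numbers $E_n$ are defined by $\frac{2}{e^x+e^{-x}}=\sum_{n\ge0}E_n\frac{x^n}{n!}$. Congruences between rational numbers whose denominators are prime to $p$ are understood in the ring of $p$-integral rationals. *)

(* Defs.v *)
From HB Require Import structures.
From mathcomp Require Import all_boot all_order all_algebra.

Set Implicit Arguments.
Unset Strict Implicit.
Unset Printing Implicit Defensive.

Import Order.TTheory GRing.Theory Num.Theory.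
Local Open Scope ring_scope.

Definition Domb (n : nat) : nat :=
  (\sum_(k < n.+1) 'C(n, k) ^ 2 * 'C(2 * k, k) * 'C(2 * n - 2 * k, n - k))%N.

(* Formal power series over rat, as coefficient sequences. *)
Definition fps := nat -> rat.

Definition fps_add (f g : fps) : fps := fun n => f n + g n.

Definition fps_mul (f g : fps) : fps :=
  fun n => \sum_(i < n.+1) f i * g (n - i)%N.

Definition fps_const (c : rat) : fps := fun n => if n is 0%N then c else 0.

(* e^(c x) *)
Definition fps_exp (c : rat) : fps := fun n => c ^+ n / (n`!)%:R.

(* The first n coefficients of f / g, by solving h * g = f from degree 0 up;
   only meaningful when g 0 != 0. *)
Fixpoint fps_div_coefs (f g : fps) (n : nat) : seq rat :=
  if n is m.+1 then
    let s := fps_div_coefs f g m in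
    rcons s ((f m - \sum_(i < m) s`_i * g (m - i)%N) / g 0%N)
  else [::].

Definition fps_div (f g : fps) : fps := fun n => (fps_div_coefs f g n.+1)`_n.

Lemma size_fps_div_coefs f g n : size (fps_div_coefs f g n) = n.
Proof. by elim: n => //= n IHn; rewrite size_rcons IHn. Qed.

Lemma nth_fps_div_coefs f g n i :
  (i < n)%N -> (fps_div_coefs f g n)`_i = fps_div f g i.
Proof.
elim: n => // n IHn; rewrite ltnS leq_eqVlt => /orP[/eqP-> //|lt_in].
by rewrite /= nth_rcons size_fps_div_coefs lt_in IHn.
Qed.

Lemma fps_divE f g n :
  fps_div f g n = (f n - \sum_(i < n) fps_div f g i * g (n - i)%N) / g 0%N.
Proof.
rewrite {1}/fps_div /= nth_rcons size_fps_div_coefs ltnn eqxx.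
by under eq_bigr => i _ do rewrite nth_fps_div_coefs //.
Qed.

Lemma fps_divK f g : g 0%N != 0 -> fps_mul (fps_div f g) g =1 f.
Proof.
move=> g0 n; rewrite /fps_mul big_ord_recr /= subnn [fps_div f g n]fps_divE.
by rewrite divfK // addrC subrK.
Qed.

Lemma fps_div_uniq f g h : g 0%N != 0 -> fps_mul h g =1 f -> h =1 fps_div f g.
Proof.
move=> g0 hg n; elim/ltn_ind: n => n IHn.
rewrite fps_divE -(hg n) /fps_mul big_ord_recr /= subnn addrC.
under [X in _ - X]eq_bigr => i _ do rewrite -IHn //.
by rewrite addrK mulfK.
Qed.

(* E_n / n! is the coefficient of x^n in 2 / (e^x + e^(-x)). *)
Definition euler_number (n : nat) : rat :=
  (n`!)%:R * fps_div (fps_const 2) (fps_add (fps_exp 1) (fps_exp (-1))) n.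

Lemma euler_numberP :
  fps_mul (fun n => euler_number n / (n`!)%:R)
          (fps_add (fps_exp 1) (fps_exp (-1))) =1 fps_const 2.
Proof.
move=> n; rewrite -[RHS](@fps_divK _ (fps_add (fps_exp 1) (fps_exp (-1)))) //.
apply: eq_bigr => i _; congr (_ * _).
by rewrite /euler_number mulrC mulKf // pnatr_eq0 -lt0n fact_gt0.
Qed.

Definition p_integral (p : nat) (x : rat) : Prop := coprimez (denq x) p.

(* x = y modulo the ideal generated by m in the ring of p-integral rationals *)
Definition p_integral_eqmod (p m : nat) (x y : rat) : Prop :=
  [/\ p_integral p x, p_integral p y &
      exists c : rat, p_integral p c /\ x - y = m%:R * c].

(* Main.v *)
Require Import Defs.
From mathcomp Require Import all_boot all_order all_algebra.
From mathcomp Require Import ring lra zify.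
From mathcomp Require cyclic.
Import Order.TTheory GRing.Theory Num.Theory.
Local Open Scope ring_scope.

(** With [p = 2n + 1] and [c_k = C(2k, k)], Zeilberger recurrences give
    [Domb m = sum_k C(m+k, 3k) C(3k, k) c_k^2 4^m / 16^k].  Summed against
    [(3m+2) / (-2)^m], the dependence on [m] telescopes, and the left-hand side
    becomes [2p 4^n sum_(k <= n) v_k prod_(j <= k) (1 + p/j) (1 - p/2j)^2] with
    [v_k = c_k c_(n-k) / c_n].  Modulo [p^3] the product is
    [1 - 3/4 p^2 H_k], where [H_k = sum_(j <= k) 1/j^2].  Since
    [sum_k v_k = 4^n / c_n], the main term is [16^n / c_n], which is [(-1)^n]
    modulo [p^3] by Morley's congruence.  Modulo [p], [v_k] is
    [(-1)^k C(n, k) C(n+k, k)], and the sum of these weighted by [H_k] equals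
    [-2 (-1)^n sum_(k <= n) (-1)^k / k^2], which the Euler polynomials at [1/2]
    identify with [-4 E_(p-3)] modulo [p]. *)

(** Denominators are shown to be positive by [lra], so the scalars lie in an ordered field and facts
    such as [0 <= k%:R] are put in context before [field]. *)
Ltac nz := rewrite -?andbA; do ?[apply/andP; split]; apply: lt0r_neq0; lra.

(** * Two expressions for the Domb numbers *)

Section Binomials.

Variable R : realFieldType.

Definition cbin (k : nat) : R := 'C(2 * k, k)%:R.

Lemma natS_neq0 (n : nat) : n.+1%:R != 0 :> R.
Proof. by rewrite pnatr_eq0. Qed.

Lemma bin_diag (n m : nat) :
  m.+1%:R * 'C(n.+1, m.+1)%:R = n.+1%:R * 'C(n, m)%:R :> R.
Proof. by rewrite -!natrM -mul_bin_diag. Qed.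

Lemma bin_left (n m : nat) :
  m.+1%:R * 'C(n, m.+1)%:R = (n%:R - m%:R) * 'C(n, m)%:R :> R.
Proof.
have [le_mn|lt_nm] := leqP m n; last by rewrite !bin_small ?mulr0 // ltnW.
by rewrite -natrB // -!natrM mul_bin_left.
Qed.

Lemma bin_down (n m : nat) :
  (n.+1%:R - m%:R) * 'C(n.+1, m)%:R = n.+1%:R * 'C(n, m)%:R :> R.
Proof. by rewrite -bin_left bin_diag. Qed.

Lemma bin_diagE (n m : nat) :
  'C(n.+1, m.+1)%:R = n.+1%:R * 'C(n, m)%:R / m.+1%:R :> R.
Proof. by rewrite -bin_diag mulrAC mulfV ?mul1r ?natS_neq0. Qed.

Lemma bin_leftE (n m : nat) :
  'C(n, m.+1)%:R = (n%:R - m%:R) * 'C(n, m)%:R / m.+1%:R :> R.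
Proof. by rewrite -bin_left mulrAC mulfV ?mul1r ?natS_neq0. Qed.

Lemma cbin0 : cbin 0 = 1. Proof. by []. Qed.

Lemma bin_downE (n m : nat) : (m <= n)%N ->
  'C(n.+1, m)%:R = n.+1%:R * 'C(n, m)%:R / (n.+1%:R - m%:R) :> R.
Proof.
move=> le_mn; rewrite -bin_down mulrAC mulfV ?mul1r //.
by rewrite -natrB 1?ltnW // subSn // natS_neq0.
Qed.

Lemma cbinS (k : nat) : cbin k.+1 = 2 * (2 * k%:R + 1) * cbin k / k.+1%:R.
Proof.
rewrite /cbin mulnS add2n bin_diagE bin_downE; last by lia.
have k0 := ler0n R k.
by field; nz.
Qed.

(** Indexing by both parts of [n = i + j] keeps truncated subtraction out of the shift formulas. *)
Definition domb_term (i j : nat) : R := cbin i * cbin j * 'C(i + j, i)%:R ^+ 2.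

Lemma domb_termC (i j : nat) : domb_term i j = domb_term j i.
Proof.
rewrite /domb_term [_ * cbin j]mulrC -[in RHS]bin_sub ?leq_addr //.
by rewrite [(j + i)%N]addnC addnK.
Qed.

Lemma domb_termSl (i j : nat) : domb_term i.+1 j =
  2 * (2 * i%:R + 1) * (i + j).+1%:R ^+ 2 / i.+1%:R ^+ 3 * domb_term i j.
Proof.
rewrite /domb_term cbinS addSn bin_diagE; have i0 := ler0n R i.
by field; nz.
Qed.

Lemma domb_termSr (i j : nat) : domb_term i j.+1 =
  2 * (2 * j%:R + 1) * (i + j).+1%:R ^+ 2 / j.+1%:R ^+ 3 * domb_term i j.
Proof. by rewrite domb_termC domb_termSl [(j + i)%N]addnC domb_termC. Qed.

Lemma DombE (n : nat) : (Domb n)%:R = \sum_(k < n.+1) domb_term k (n - k).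
Proof.
rewrite natr_sum; apply: eq_bigr => k _.
by rewrite /domb_term subnKC -1?ltnS // -mulnBr !natrM /cbin; ring.
Qed.

(** The recurrence operator of the Domb numbers, kept as a linear form so that it applies termwise
    to sums. *)
Definition domb_rec (n : nat) (a0 a1 a2 : R) : R :=
  (n%:R + 2) ^+ 3 * a2
  - 2 * (2 * n%:R + 3) * (5 * n%:R ^+ 2 + 15 * n%:R + 12) * a1
  + 64 * (n%:R + 1) ^+ 3 * a0.

Lemma domb_rec_sum (n m : nat) (a0 a1 a2 : 'I_m -> R) :
  domb_rec n (\sum_(k < m) a0 k) (\sum_(k < m) a1 k) (\sum_(k < m) a2 k)
  = \sum_(k < m) domb_rec n (a0 k) (a1 k) (a2 k).
Proof. by rewrite /domb_rec big_split sumrB /= !mulr_sumr. Qed.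

(* Numerator of the Zeilberger certificate of the defining sum. *)
Definition domb_cert (n k : nat) : R :=
  let x : R := n%:R in let y : R := k%:R in
  (x + 1) ^+ 2 * (16 * y ^+ 3 - (72 * x + 120) * y ^+ 2
    + (104 * x ^+ 2 + 356 * x + 296) * y
    - (48 * x ^+ 3 + 248 * x ^+ 2 + 416 * x + 224)).

(** Partial sums of the creative telescoping relation. The induction is general in [j]: with
    [n = m + j] fixed, raising [m] lowers [j]. *)
Lemma domb_rec_partial (m j : nat) : let n := (m + j)%N in
  \sum_(k < m.+1) domb_rec n (domb_term k (n - k)) (domb_term k (n.+1 - k))
    (domb_term k (n.+2 - k))
  = domb_cert n m.+1 * (2 * m%:R + 1) / j.+1%:R ^+ 3 * domb_term m j.
Proof.
elim: m j => [|m IHm] j n.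
  rewrite big_ord_recr big_ord0 /= add0r !subn0 /n add0n.
  rewrite !domb_termSr /domb_rec /domb_cert; have j0 := ler0n R j.
  by field; nz.
rewrite big_ord_recr /=.
rewrite (_ : (n.+2 - m.+1 = j.+2)%N); last by rewrite /n; lia.
rewrite (_ : (n.+1 - m.+1 = j.+1)%N); last by rewrite /n; lia.
rewrite (_ : (n - m.+1 = j)%N); last by rewrite /n; lia.
have := IHm j.+1; rewrite addnS -addSn -/n => ->.
rewrite domb_termSl !domb_termSr domb_termSl /domb_rec /domb_cert.
have j0 := ler0n R j; have m0 := ler0n R m.
rewrite /n; field; nz.
Qed.

Lemma Domb_recurrence (n : nat) :
  domb_rec n (Domb n)%:R (Domb n.+1)%:R (Domb n.+2)%:R = 0.
Proof.
have h := domb_rec_partial n 0; rewrite addn0 /= -domb_rec_sum -DombE in h.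
rewrite [(Domb n.+1)%:R]DombE [(Domb n.+2)%:R]DombE.
rewrite big_ord_recr [X in domb_rec _ _ _ X]big_ord_recr.
rewrite [X in domb_rec _ _ _ (X + _)]big_ord_recr /= !subnn subSnn.
(* The closed form covers [k <= n]. The terms left over, [k = n+1] in the two longer sums and
   [k = n+2] in the longest, are split off by linearity and cancel it. *)
have recD a0 a1 a2 b1 b2 b3 : domb_rec n a0 (a1 + b1) (a2 + b2 + b3)
    = domb_rec n a0 a1 a2 + domb_rec n 0 b1 (b2 + b3).
  by rewrite /domb_rec; ring.
rewrite recD h !domb_termSl !domb_termSr /domb_rec /domb_cert.
have n0 := ler0n R n.
by field; nz.
Qed.

(** * The expression through [C(n+k, 3k)] *)

Definition alt_weight (k : nat) : R := 'C(3 * k, k)%:R * cbin k ^+ 2 / 16 ^+ k.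

Lemma alt_weightS (k : nat) : alt_weight k.+1 =
  3 * (3 * k%:R + 1) * (3 * k%:R + 2) * (2 * k%:R + 1) / (8 * k.+1%:R ^+ 3)
  * alt_weight k.
Proof.
rewrite /alt_weight cbinS mulnS !addSn add0n bin_diagE !bin_downE; try lia.
have k0 := ler0n R k; rewrite (exprS 16); field.
by rewrite expf_neq0 ?pnatr_eq0 //=; nz.
Qed.

Definition domb_alt_term (n k : nat) : R :=
  'C(n + k, 3 * k)%:R * alt_weight k * 4 ^+ n.

(** The same operator telescopes here too; the right-hand side vanishes once [2m > n], because
    [C(n+m, 3m)] does. *)
Lemma domb_alt_partial (n m : nat) :
  \sum_(k < m.+1) domb_rec n (domb_alt_term n k) (domb_alt_term n.+1 k)
     (domb_alt_term n.+2 k)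
  = - 24 * (3 * n%:R + 4) * (n%:R + m%:R + 1) * (2 * m%:R + 1)
    * domb_alt_term n m.
Proof.
elim: m => [|m IHm].
  rewrite big_ord_recr big_ord0 /= add0r /domb_rec /domb_alt_term !bin0 !exprS.
  by ring.
rewrite big_ord_recr {}IHm /= /domb_rec /domb_alt_term alt_weightS.
rewrite [(3 * m.+1)%N]mulnS !addSn add0n !addnS !bin_diagE !bin_leftE.
rewrite !(exprS 4); have m0 := ler0n R m.
by field; nz.
Qed.

Lemma domb_alt_sum (n m : nat) : (n <= m)%N ->
  \sum_(k < m.+1) domb_alt_term n k = \sum_(k < n.+1) domb_alt_term n k.
Proof.
move=> le_nm; rewrite -!(big_mkord xpredT (domb_alt_term n)).
rewrite (big_cat_nat (n := n.+1)) //= [X in _ + X]big_nat [X in _ + X]big1 ?addr0 //.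
by move=> k /andP[lt_nk _]; rewrite /domb_alt_term bin_small ?mul0r //; lia.
Qed.

(** Both sides satisfy the same second-order recurrence, whose leading coefficient [(n+2)^3] is
    nonzero, and agree at 0 and 1. *)
Lemma Domb_alt (n : nat) : (Domb n)%:R = \sum_(k < n.+1) domb_alt_term n k.
Proof.
suff: (Domb n)%:R = \sum_(k < n.+1) domb_alt_term n k
  /\ (Domb n.+1)%:R = \sum_(k < n.+2) domb_alt_term n.+1 k by case.
elim: n => [|n [IH0 IH1]].
  have D0 : Domb 0 = 1%N by rewrite /Domb big_ord_recr big_ord0.
  have D1 : Domb 1 = 4%N by rewrite /Domb !big_ord_recr big_ord0.
  rewrite D0 D1 !big_ord_recr !big_ord0 /= /domb_alt_term.
  rewrite !bin0 (_ : 'C(1 + 1, 3 * 1) = 0%N) // /alt_weight bin0 cbin0.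
  by split; field.
split=> //; have n2 : (n%:R + 2) ^+ 3 != 0 :> R.
  by have n0 := ler0n R n; apply: expf_neq0; nz.
apply: (mulfI n2).
(* At [m = n + 2] all three sums are complete and the closed form is zero. *)
have := domb_alt_partial n n.+2; rewrite -domb_rec_sum !domb_alt_sum // 1?ltnW //.
rewrite [domb_alt_term n n.+2]/domb_alt_term bin_small; last by lia.
rewrite !mul0r mulr0 -IH0 -IH1; have := Domb_recurrence n; rewrite /domb_rec.
by move=> h1 h2; have /addIr/addIr := etrans h1 (esym h2).
Qed.

(** Telescopes because [3N + 2 - (N - 2k) = 2(N + 1 + k)], and [bin_down] absorbs [N + 1 + k] into
    the next binomial coefficient. *)
Lemma sum_bin_telescope (N k : nat) :
  \sum_(n < N) (3 * n%:R + 2) * (-2) ^+ n * 'C(n + k, 3 * k)%:R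
  = - (-2) ^+ N * (N%:R - 2 * k%:R) * 'C(N + k, 3 * k)%:R :> R.
Proof.
elim: N => [|N IHN].
  rewrite big_ord0; case: k => [|k]; first by ring.
  by rewrite bin_small ?mulr0 //; lia.
rewrite big_ord_recr /= {}IHN exprS; have := bin_down (N + k) (3 * k).
rewrite addSn (_ : _ - _ = N.+1%:R - 2 * k%:R); last by ring.
rewrite -!mulrA => ->; ring.
Qed.

Lemma weighted_Domb_sum (N : nat) :
  \sum_(k < N) (3 * k + 2)%:R / (-2) ^+ k * (Domb k)%:R
  = - (-2) ^+ N * \sum_(k < N)
      (N%:R - 2 * k%:R) * 'C(N + k, 3 * k)%:R * alt_weight k :> R.
Proof.
case: N => [|N]; first by rewrite !big_ord0 mulr0.
transitivity (\sum_(n < N.+1) \sum_(k < N.+1)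
   alt_weight k * ((3 * n%:R + 2) * (-2) ^+ n * 'C(n + k, 3 * k)%:R)).
  apply: eq_bigr => n _; rewrite Domb_alt -(@domb_alt_sum n N) -1?ltnS //.
  rewrite mulr_sumr; apply: eq_bigr => k _; rewrite /domb_alt_term.
  rewrite (_ : 4 ^+ n = (-2) ^+ n * (-2) ^+ n); last first.
    by rewrite -exprMn; congr (_ ^+ _); ring.
  by field; rewrite expf_neq0 // oppr_eq0 pnatr_eq0.
rewrite exchange_big mulr_sumr; apply: eq_bigr => k _ /=.
by rewrite -mulr_sumr sum_bin_telescope; ring.
Qed.

Lemma cbin_gt0 (k : nat) : 0 < cbin k.
Proof. by rewrite /cbin ltr0n bin_gt0 mul2n -addnn leq_addr. Qed.

(* Symmetry gives [sum k c_k c_(m-k) = m/2 sum c_k c_(m-k)]; at [m = n.+1],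
   [(k+1) c_(k+1) = (4k+2) c_k] turns the left-hand side into sums at [n]. *)
Lemma cbin_conv (n : nat) : \sum_(k < n.+1) cbin k * cbin (n - k) = 4 ^+ n.
Proof.
elim: n => [|n IHn]; first by rewrite big_ord1 mulr1.
pose S (w : nat -> R) m := \sum_(k < m.+1) w k * (cbin k * cbin (m - k)).
have Ssym m : S (fun k => k%:R) m = m%:R / 2 * S (fun=> 1) m.
  suff: 2 * S (fun k => k%:R) m = m%:R * S (fun=> 1) m.
    by move=> h; apply: (@mulfI _ 2); rewrite ?pnatr_eq0 // h; field.
  rewrite mulrDl mul1r [X in X + _]/S (reindex_inj rev_ord_inj) /= /S.
  rewrite -big_split mulr_sumr; apply: eq_bigr => k _ /=.
  have le_km : (k <= m)%N by rewrite -ltnS.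
  by rewrite subSS (subKn le_km) natrB //; ring.
have := Ssym n.+1; rewrite {1}/S big_ord_recl mul0r add0r.
under eq_bigr => k _.
  rewrite lift0 subSS cbinS.
  have -> : k.+1%:R * (2 * (2 * k%:R + 1) * cbin k / k.+1%:R * cbin (n - k))
     = 4 * (k%:R * (cbin k * cbin (n - k))) + 2 * (1 * (cbin k * cbin (n - k))).
    by have k0 := ler0n R k; field; nz.
  over.
rewrite big_split /= -!mulr_sumr -/(S (fun k => k%:R) n) -/(S (fun=> 1) n) Ssym.
have S1 m : S (fun=> 1) m = \sum_(k < m.+1) cbin k * cbin (m - k).
  by apply: eq_bigr => k _; rewrite mul1r.
rewrite !S1 IHn exprS => h; have n0 := ler0n R n.
have nz1 : n.+1%:R / 2 != 0 :> R by apply: lt0r_neq0; lra.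
by apply: (mulfI nz1); rewrite -h; field.
Qed.

(** Both sides equal [p] at [k = 0] and have the same ratio of consecutive terms when [p = 2n + 1].
    The product form puts [p] into factors that expand [p]-adically. *)
Lemma hyper_term (p n k : nat) : (k <= n)%N -> p = (2 * n).+1 ->
  (p%:R - 2 * k%:R) * 'C(p + k, 3 * k)%:R * alt_weight k
  = p%:R * (cbin k * cbin (n - k) / cbin n)
    * \prod_(j < k) ((1 + p%:R / j.+1%:R) * (1 - p%:R / (2 * j.+1%:R)) ^+ 2).
Proof.
move=> + Dp; elim: k => [|k IHk] le_kn.
  rewrite big_ord0 bin0 subn0 cbin0 /alt_weight bin0 cbin0.
  by have := cbin_gt0 n => c0; field; nz.
rewrite big_ord_recr /=.
have [i Dn] : exists i, n = (k + i).+1 by exists (n - k.+1)%N; lia.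
have k0 := ler0n R k; have i0 := ler0n R i; have cn := cbin_gt0 n.
have DpR : p%:R = 2 * k%:R + 2 * i%:R + 3 :> R by rewrite Dp Dn; ring.
have {IHk} := IHk (ltnW le_kn).
have -> : (n - k = i.+1)%N by lia.
have -> : (n - k.+1 = i)%N by lia.
rewrite alt_weightS [cbin i.+1]cbinS [cbin k.+1]cbinS.
rewrite [(3 * k.+1)%N]mulnS !addSn add0n addnS bin_diagE !bin_leftE.
set P := \prod_(_ < _) _; set c := 'C(_, _)%:R; set w := alt_weight k => h.
(* The term at [k + 1] is its ratio times the term at [k], to which the induction hypothesis
   applies. *)
transitivity ((p%:R - 2 * k.+1%:R) * (p%:R + k%:R + 1) * (p%:R - 2 * k%:R - 1)
    * (2 * k%:R + 1) / (8 * k.+1%:R ^+ 4) * ((p%:R - 2 * k%:R) * c * w)).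
  by field; nz.
by rewrite h DpR; field; nz.
Qed.

(** * Legendre coefficients weighted by harmonic numbers of order 2 *)

Definition harm2 (k : nat) : R := \sum_(j < k) (j.+1%:R ^+ 2)^-1.

(** Coefficients of the Legendre polynomial [P_n(1 - 2x)]. *)
Definition legendre_term (n k : nat) : R := (-1) ^+ k * 'C(n, k)%:R * 'C(n + k, k)%:R.

(** Adding the sums for [n] and [n + 1] makes them telescope; at [m = n + 1] only [-2 / (n+1)^2]
    survives. *)
Lemma legendre_harm2_partial (n m : nat) :
  \sum_(k < m.+1) (legendre_term n.+1 k + legendre_term n k) * harm2 k
  = 2 * (-1) ^+ m * 'C(n, m)%:R * 'C(n.+1 + m, m)%:R
      * (harm2 m + (n.+1%:R ^+ 2)^-1) - 2 / n.+1%:R ^+ 2.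
Proof.
have n0 := ler0n R n.
elim: m => [|m IHm].
  by rewrite big_ord1 /harm2 big_ord0 !bin0; field; nz.
rewrite big_ord_recr {}IHm /= /legendre_term.
have -> : harm2 m.+1 = harm2 m + (m.+1%:R ^+ 2)^-1 by rewrite /harm2 big_ord_recr.
rewrite !addSn !addnS !bin_diagE !bin_leftE (exprS (-1)) bin_downE ?leq_addl //.
by have m0 := ler0n R m; field; nz.
Qed.

Lemma legendre_harm2 (n : nat) : \sum_(k < n.+1) legendre_term n k * harm2 k
  = - 2 * (-1) ^+ n * \sum_(k < n) (-1) ^+ k.+1 / k.+1%:R ^+ 2.
Proof.
elim: n => [|n IHn].
  by rewrite big_ord1 /harm2 !big_ord0 !mulr0.
have := legendre_harm2_partial n n.+1.
rewrite bin_small // mulr0 !mul0r add0r.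
under eq_bigr => k _ do rewrite mulrDl.
rewrite big_split /= [X in _ + X]big_ord_recr /= IHn.
rewrite [X in _ + (_ + X)](_ : _ = 0); last first.
  by rewrite /legendre_term bin_small // mulr0 !mul0r.
rewrite addr0 => /(canRL (addrK _)) ->.
rewrite [in RHS]big_ord_recr /= (exprS (-1)); set S := \sum_(_ < n) _.
have s1 : (-1) ^+ n * (-1) ^+ n = 1 :> R by rewrite -expr2 sqrr_sign.
transitivity (2 * (-1) ^+ n * S - 2 * ((-1) ^+ n * (-1) ^+ n) / n.+1%:R ^+ 2).
  by rewrite s1; ring.
by have n0 := ler0n R n; field; nz.
Qed.

End Binomials.

(** * Congruences between p-integral rationals *)

(** The reduced denominator divides [d]; for [d = 0] the quotient is 0 by convention. *)
Lemma p_integral_frac (p d : nat) (a : int) :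
  coprime d p -> p_integral p (a%:~R / d%:R).
Proof.
move=> cop_dp; set x := _ / _; have [d0|d_gt0] := posnP d.
  by rewrite /x d0 invr0 mulr0 -[0]/(0%:Q) /p_integral denq_int coprimezE coprime1n.
have dx : (denq x %| d%:Z)%Z.
  suff: (denq x %| numq x * d%:Z)%Z.
    by rewrite Gauss_dvdzr // coprimez_sym; apply: coprime_num_den.
  apply/dvdzP; exists a; apply: (intr_inj (R := rat)).
  rewrite !intrM -[numq x]mulr1 intrM mulr1 numqE /x mulrAC pmulrn.
  by rewrite divfK // intr_eq0; lia.
rewrite /p_integral; apply: coprimez_dvdl dx _; by rewrite coprimezE.
Qed.

Section PIntegral.

Variable p : nat.

Local Notation pint := (p_integral p).

Lemma p_integralP (x : rat) :
  pint x -> exists a : int, exists2 d : nat, (0 < d)%N && coprime d p & x = a%:~R / d%:R.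
Proof.
move=> px; exists (numq x); exists `|denq x|%N.
  by rewrite absz_gt0 denq_neq0 /= -(absz_nat p).
by rewrite -{1}[x]divq_num_den -absz_denq.
Qed.

Lemma p_integral_int (z : int) : pint z%:~R.
Proof. by rewrite /p_integral denq_int coprimezE coprime1n. Qed.

Lemma p_integral_nat (n : nat) : pint n%:R.
Proof. exact: (p_integral_int n). Qed.

Lemma p_integralD (x y : rat) : pint x -> pint y -> pint (x + y).
Proof.
move=> /p_integralP[a [d /andP[d0 cd] ->]] /p_integralP[b [e /andP[e0 ce] ->]].
have -> : a%:~R / d%:R + b%:~R / e%:R = (a * e%:Z + b * d%:Z)%:~R / (d * e)%:R :> rat.
  rewrite natrM rmorphD !rmorphM /= -!pmulrn; field.
  by rewrite !pnatr_eq0 -!lt0n d0 e0.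
by apply: p_integral_frac; rewrite coprimeMl cd.
Qed.

Lemma p_integralM (x y : rat) : pint x -> pint y -> pint (x * y).
Proof.
move=> /p_integralP[a [d /andP[d0 cd] ->]] /p_integralP[b [e /andP[e0 ce] ->]].
have -> : a%:~R / d%:R * (b%:~R / e%:R) = (a * b)%:~R / (d * e)%:R :> rat.
  rewrite natrM rmorphM /=; field.
  by rewrite !pnatr_eq0 -!lt0n d0 e0.
by apply: p_integral_frac; rewrite coprimeMl cd.
Qed.

Lemma p_integralN (x : rat) : pint x -> pint (- x).
Proof.
by move=> px; rewrite -mulN1r; apply: p_integralM px; apply: (p_integral_int (-1)).
Qed.

Lemma p_integralX (x : rat) (n : nat) : pint x -> pint (x ^+ n).
Proof.
move=> px; elim: n => [|n IHn]; first exact: (p_integral_nat 1).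
by rewrite exprS; apply: p_integralM.
Qed.

Lemma p_integral_sign (n : nat) : pint ((-1) ^+ n).
Proof. exact/p_integralX/(p_integral_int (-1)). Qed.

Lemma p_integral_sum (I : Type) (r : seq I) (P : pred I) (F : I -> rat) :
  (forall i, P i -> pint (F i)) -> pint (\sum_(i <- r | P i) F i).
Proof.
by move=> pF; apply: big_ind pF; [apply: (p_integral_nat 0)|apply: p_integralD].
Qed.

Lemma p_integralV (d : nat) : coprime d p -> pint d%:R^-1.
Proof. by move=> cd; rewrite -[_^-1]mul1r; apply: (p_integral_frac p d 1). Qed.

End PIntegral.

(** Inverses are not decomposed: their integrality must stand among the hypotheses. *)
Ltac pint_auto := repeat first
  [ assumption
  | match goal with
    | |- p_integral _ (_ + _) => apply: p_integralD
    | |- p_integral _ (- _) => apply: p_integralN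
    | |- p_integral _ (_ * _) => apply: p_integralM
    | |- p_integral _ (_ ^+ _) => apply: p_integralX
    | |- p_integral _ (_%:R) => apply: p_integral_nat
    | |- p_integral ?p 1 => apply: (p_integral_nat p 1)
    end ].

Section PCongruence.

Variable p : nat.

Local Notation pint := (p_integral p).

(** The modulus is [p^r]. Integrality of the sides is kept apart and asked for only where a product
    needs it. *)
Definition pcong (r : nat) (x y : rat) : Prop :=
  exists2 c, pint c & x - y = p%:R ^+ r * c.

Lemma pcong_refl (r : nat) (x : rat) : pcong r x x.
Proof. by exists 0; [apply: (p_integral_nat p 0)|rewrite subrr mulr0]. Qed.

Lemma pcong_trans (r : nat) (x y z : rat) : pcong r x y -> pcong r y z -> pcong r x z.
Proof.
move=> [c pc xy] [d pd yz]; exists (c + d); first exact: p_integralD.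
by rewrite mulrDr -xy -yz; ring.
Qed.

Lemma pcong_sym (r : nat) (x y : rat) : pcong r x y -> pcong r y x.
Proof.
by move=> [c pc xy]; exists (- c); [apply: p_integralN|rewrite mulrN -xy opprB].
Qed.

Lemma pcongD (r : nat) (x x' y y' : rat) :
  pcong r x x' -> pcong r y y' -> pcong r (x + y) (x' + y').
Proof.
move=> [c pc xx] [d pd yy]; exists (c + d); first exact: p_integralD.
by rewrite mulrDr -xx -yy; ring.
Qed.

(** Rests on [xy - x'y' = (x - x') y' + x (y - y')]. *)
Lemma pcongM (r : nat) (x x' y y' : rat) : pint x -> pint y' ->
  pcong r x x' -> pcong r y y' -> pcong r (x * y) (x' * y').
Proof.
move=> px py' [c pc xx] [d pd yy]; exists (c * y' + x * d).
  by apply: p_integralD; apply: p_integralM.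
by rewrite mulrDr mulrA -xx mulrCA -yy; ring.
Qed.

Lemma pcongMl (r : nat) (a x y : rat) : pint a -> pcong r x y -> pcong r (a * x) (a * y).
Proof.
move=> pa [c pc xy]; exists (a * c); first exact: p_integralM.
by rewrite -mulrBr xy mulrCA.
Qed.

(** With [s = 2] this carries congruences modulo [p] to modulus [p^3]. *)
Lemma pcong_scale (r s : nat) (x y : rat) :
  pcong r x y -> pcong (s + r) (p%:R ^+ s * x) (p%:R ^+ s * y).
Proof. by move=> [c pc xy]; exists c => //; rewrite -mulrBr xy exprD mulrA. Qed.

Lemma pcong_sum (r n : nat) (F G : 'I_n -> rat) :
  (forall i, pcong r (F i) (G i)) -> pcong r (\sum_i F i) (\sum_i G i).
Proof.
move=> FG; apply: (big_ind2 (pcong r)); [exact: pcong_refl| |by []].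
by move=> *; apply: pcongD.
Qed.

Lemma pcong_int (r : nat) (x y : rat) : pcong r x y -> pint y -> pint x.
Proof.
move=> [c pc xy] py; rewrite -[x](subrK y) xy.
by apply: p_integralD py; apply: p_integralM pc; apply/p_integralX/p_integral_nat.
Qed.

Lemma pcong_mod (a b : nat) : a = b %[mod p] -> pcong 1 a%:R b%:R.
Proof.
move=> /eqP; wlog le_ba : a b / (b <= a)%N => [h|].
  have [/h//|/ltnW/h {}h] := leqP b a; rewrite eq_sym => /h; exact: pcong_sym.
rewrite eqn_mod_dvd // => /dvdnP[c Dc]; exists c%:R; first exact: p_integral_nat.
by rewrite -natrB // Dc natrM mulrC.
Qed.

Lemma pcongV (r : nat) (x y : rat) : x != 0 -> y != 0 ->
  pint x^-1 -> pint y^-1 -> pcong r x y -> pcong r x^-1 y^-1.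
Proof.
move=> x0 y0 px py [c pc xy]; exists (- c * x^-1 * y^-1).
  by pint_auto.
have -> : p%:R ^+ r * (- c * x^-1 * y^-1) = - (x - y) * x^-1 * y^-1 by rewrite xy; ring.
by field; rewrite x0 y0.
Qed.

End PCongruence.

(** * Euler numbers *)

Lemma euler_number_conv (n : nat) :
  \sum_(i < n.+1) 'C(n, i)%:R * euler_number i * (1 + (-1) ^+ (n - i))
  = if n == 0%N then 2 else 0.
Proof.
have := congr1 (fun x => n`!%:R * x) (euler_numberP n).
have -> : n`!%:R * fps_const 2 n = if n == 0%N then 2 else 0.
  by case: n => [|n]; rewrite /fps_const ?mul1r ?mulr0.
move=> <-; rewrite /fps_mul mulr_sumr; apply: eq_bigr => i _.
have le_in : (i <= n)%N by rewrite -ltnS.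
rewrite -(bin_fact le_in) /fps_add /fps_exp expr1n !natrM.
by field; rewrite !pnatr_eq0 -!lt0n !fact_gt0.
Qed.

(** Halving the convolution leaves integer coefficients, whence the integrality of Euler numbers. *)
Lemma euler_number_rec (n : nat) : euler_number n =
  (n == 0%N)%:R - \sum_(i < n) 'C(n, i)%:R * euler_number i * (~~ odd (n - i))%:R.
Proof.
have h m : 1 + (-1) ^+ m = 2 * (~~ odd m)%:R :> rat.
  by rewrite -signr_odd; case: (odd m); rewrite /= ?expr1 ?expr0; ring.
have := euler_number_conv n; rewrite big_ord_recr /= subnn binn.
under eq_bigr => i _ do rewrite h mulrCA.
rewrite -mulr_sumr; set S := \sum_(_ < n) _.
case: (n == 0%N) => /= e; lra.
Qed.

Lemma euler_number_int (p n : nat) : p_integral p (euler_number n).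
Proof.
elim/ltn_ind: n => n IHn; rewrite euler_number_rec.
apply: p_integralD; first exact: p_integral_nat.
apply/p_integralN/p_integral_sum => i _.
do 2![apply: p_integralM; last by [apply: p_integral_nat|apply: IHn]].
exact: p_integral_nat.
Qed.

Lemma euler_number_odd (n : nat) : odd n -> euler_number n = 0.
Proof.
elim/ltn_ind: n => n IHn odd_n; rewrite euler_number_rec big1 => [|i _].
  by case: n odd_n {IHn} => // n _; rewrite subr0.
have [odd_i|even_i] := boolP (odd i); first by rewrite IHn // mulr0 mul0r.
by rewrite oddB 1?ltnW // odd_n (negPf even_i) mulr0.
Qed.

(* [euler_poly m y = 2 ^ m * E_m ((y + 1) / 2)] for the classical Euler
   polynomials [E_m]; this normalisation avoids denominators. *)
Definition euler_poly (m : nat) (y : rat) : rat :=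
  \sum_(k < m.+1) 'C(m, k)%:R * euler_number k * y ^+ (m - k).

(** Both sides are the multinomial coefficient [m! / (k! t! (m-k-t)!)], or 0 when [k + t > m]. *)
Lemma mul_bin_swap (m k t : nat) : (k <= m)%N -> (t <= m)%N ->
  ('C(m, k) * 'C(m - k, t) = 'C(m, t) * 'C(m - t, k))%N.
Proof.
move=> le_km le_tm; have [le_ktm|lt_mkt] := leqP (k + t) m; last first.
  by rewrite [X in (_ * X = _)%N]bin_small ?[X in (_ = _ * X)%N]bin_small ?muln0 //; lia.
apply/eqP; rewrite -(eqn_pmul2r (fact_gt0 (m - k - t))).
rewrite -(eqn_pmul2r (fact_gt0 k)) -(eqn_pmul2r (fact_gt0 t)); apply/eqP.
transitivity (m`!); last symmetry.
  rewrite -[RHS](bin_fact le_km) -(@bin_fact (m - k) t); last by lia.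
  by ring.
rewrite -[RHS](bin_fact le_tm) -(@bin_fact (m - t) k); last by lia.
by rewrite (_ : m - k - t = m - t - k)%N; [ring|lia].
Qed.

Lemma exprD_wide (x y : rat) (d m : nat) : (d <= m)%N ->
  (x + y) ^+ d = \sum_(t < m.+1) x ^+ (d - t) * y ^+ t * 'C(d, t)%:R.
Proof.
move=> le_dm; rewrite exprDn.
rewrite -!(big_mkord xpredT (fun t => x ^+ (d - t) * y ^+ t *+ 'C(d, t))).
rewrite -(big_mkord xpredT (fun t => x ^+ (d - t) * y ^+ t * 'C(d, t)%:R)).
rewrite [RHS](big_cat_nat (n := d.+1)) //= [X in _ = _ + X]big_nat [X in _ = _ + X]big1.
  by rewrite addr0; apply: eq_bigr => t _; rewrite mulr_natr.
by move=> t /andP[lt_dt _]; rewrite bin_small ?mulr0.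
Qed.

(** The coefficient of [y^t] is [C(m, t)] times the Euler convolution at [m - t], which vanishes
    unless [t = m]. *)
Lemma euler_poly_shift (m : nat) (y : rat) :
  euler_poly m (y + 1) + euler_poly m (y - 1) = 2 * y ^+ m.
Proof.
rewrite /euler_poly -big_split /=.
transitivity (\sum_(k < m.+1) \sum_(t < m.+1)
   y ^+ t * 'C(m, t)%:R * ('C(m - t, k)%:R * euler_number k * (1 + (-1) ^+ (m - t - k)))).
  apply: eq_bigr => k _; have le_km : (k <= m)%N by rewrite -ltnS.
  rewrite addrC [y - 1]addrC [y + 1]addrC.
  rewrite !(@exprD_wide _ y (m - k) m) ?leq_subr // -mulrDr -big_split mulr_sumr.
  apply: eq_bigr => t _ /=; have le_tm : (t <= m)%N by rewrite -ltnS.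
  have := congr1 (fun x => x%:R : rat) (mul_bin_swap _ _ _ le_km le_tm).
  rewrite !natrM expr1n subnAC => e.
  transitivity ('C(m, k)%:R * 'C(m - k, t)%:R * euler_number k * y ^+ t
                * (1 + (-1) ^+ (m - t - k))).
    by ring.
  by rewrite e; ring.
rewrite exchange_big /= big_ord_recr /= big1 => [|t _]; last first.
  rewrite -mulr_sumr; apply/eqP; rewrite mulf_eq0; apply/orP; right; apply/eqP.
  have lt_tm : (t < m)%N by [].
  have := euler_number_conv (m - t); rewrite subn_eq0 leqNgt lt_tm /= => e.
  rewrite -(big_mkord xpredT (fun k =>
    'C(m - t, k)%:R * euler_number k * (1 + (-1) ^+ (m - t - k)))).
  rewrite (big_cat_nat (n := (m - t).+1)) //=; last by lia.
  rewrite big_mkord e add0r big_nat big1 // => k /andP[lt_k _].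
  by rewrite bin_small // !mul0r.
rewrite add0r subnn binn big_ord_recl big1 => [|k _]; last first.
  by rewrite lift0 !mul0r mulr0.
have := euler_number_conv 0; rewrite big_ord1 /= => ->.
by ring.
Qed.

(** For even [m] only even powers of [y] occur, so the values at 1 and -1 agree, while the shift
    identity at 0 makes them opposite. *)
Lemma euler_poly_opp1 (m : nat) : ~~ odd m -> (0 < m)%N -> euler_poly m (-1) = 0.
Proof.
move=> even_m m_gt0; have := euler_poly_shift m 0.
rewrite add0r sub0r expr0n eqn0Ngt m_gt0 mulr0.
suff -> : euler_poly m 1 = euler_poly m (-1) by move=> /=; lra.
apply: eq_bigr => k _; have [odd_k|even_k] := boolP (odd k).
  by rewrite euler_number_odd // mulr0 !mul0r.
rewrite expr1n -signr_odd oddB -1?ltnS // (negPf even_m) (negPf even_k).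
by rewrite expr0.
Qed.

(** The shift identity at [y = 2k] turns each power into two neighbouring values of [euler_poly];
    the alternating sum telescopes from [euler_poly m 1 = 0]. *)
Lemma alternating_power_sum (m n : nat) : ~~ odd m -> (0 < m)%N ->
  2 * \sum_(k < n) (-1) ^+ k.+1 * (2 * k.+1%:R) ^+ m
  = (-1) ^+ n * euler_poly m (2 * n).+1%:R.
Proof.
move=> even_m m_gt0; elim: n => [|n IHn].
  rewrite big_ord0 mulr0 mul1r; have := euler_poly_shift m 0.
  rewrite sub0r euler_poly_opp1 // addr0 add0r expr0n eqn0Ngt m_gt0 mulr0.
  by move=> /= ->.
rewrite big_ord_recr mulrDr {}IHn /=; have := euler_poly_shift m (2 * n.+1%:R).
rewrite (_ : 2 * n.+1%:R - 1 = (2 * n).+1%:R); last by ring.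
rewrite (_ : 2 * n.+1%:R + 1 = (2 * n.+1).+1%:R); last by ring.
by move=> /(canRL (addrK _)) ->; rewrite exprS; ring.
Qed.

Lemma euler_poly_mod (p m : nat) : pcong p 1 (euler_poly m p%:R) (euler_number m).
Proof.
rewrite /euler_poly big_ord_recr /= binn subnn expr0 mulr1 mul1r.
exists (\sum_(k < m) 'C(m, k)%:R * euler_number k * p%:R ^+ (m - k).-1).
  apply: p_integral_sum => k _; apply: p_integralM.
    by apply: p_integralM; [apply: p_integral_nat|apply: euler_number_int].
  by apply/p_integralX/p_integral_nat.
rewrite addrK mulr_sumr; apply: eq_bigr => k _.
have -> : (m - k = (m - k).-1.+1)%N by have := ltn_ord k; lia.
by rewrite exprS /=; ring.
Qed.

(** * Evaluation modulo powers of p *)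

Lemma coprime_small (p k : nat) : prime p -> (0 < k < p)%N -> coprime k p.
Proof.
move=> pr_p /andP[k0 kp]; rewrite coprime_sym prime_coprime //.
by apply: contraL kp => /(dvdn_leq k0); rewrite -leqNgt.
Qed.

Lemma prod_bin (m k : nat) :
  \prod_(j < k) ((m%:R - j%:R) / j.+1%:R) = 'C(m, k)%:R :> rat.
Proof.
elim: k => [|k IHk]; first by rewrite big_ord0 bin0.
by rewrite big_ord_recr /= IHk bin_leftE; ring.
Qed.

Lemma cbin_prod1 (n : nat) :
  cbin rat n = (-1) ^+ n * \prod_(j < n) (1 - (2 * n).+1%:R / j.+1%:R).
Proof.
rewrite /cbin -prod_bin -[n in (-1) ^+ n]card_ord -prodr_const -big_split.
apply: eq_bigr => j _ /=; have j0 := ler0n rat j.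
by field; nz.
Qed.

Lemma cbin_prod2 (n : nat) :
  cbin rat n = (-4) ^+ n * \prod_(j < n) (1 - (2 * n).+1%:R / (2 * j.+1%:R)).
Proof.
have -> : \prod_(j < n) (1 - (2 * n).+1%:R / (2 * j.+1%:R))
   = \prod_(j < n) - (2 * j%:R + 1) * \prod_(j < n) (2 * j.+1%:R)^-1 :> rat.
  (* Under [j -> n - 1 - j] the numerators [2j + 1 - 2n] become [-(2j + 1)], up to sign the odd
     numbers in [c_n = 2^n prod (2j+1)/(j+1)]. *)
  rewrite [X in _ = X * _](reindex_inj rev_ord_inj) -big_split /=.
  apply: eq_bigr => j _; rewrite natrB //; have j0 := ler0n rat j.
  by field; nz.
rewrite -[n in (-4) ^+ n]card_ord -prodr_const -!big_split /=.
elim: n => [|n IHn]; first by rewrite big_ord0.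
rewrite big_ord_recr /= -IHn cbinS; have n0 := ler0n rat n.
by field; nz.
Qed.

(** * Congruences for a prime [p = 2n + 1] *)

Section Modp.

Variables (p n : nat).
Hypotheses (pr_p : prime p) (p_ge5 : (5 <= p)%N) (Dp : p = (2 * n).+1).

Local Notation pint := (p_integral p).
Local Notation cong := (pcong p).
Local Notation H2 := (harm2 rat).
Local Notation P := (p%:R : rat).

Lemma p_integralV_small (k : nat) : (0 < k < p)%N -> pint k%:R^-1.
Proof. by move=> lt_kp; apply/p_integralV/coprime_small. Qed.

Lemma p_integralV4 : pint 4^-1.
Proof. by apply: (p_integralV_small 4); rewrite (leq_trans _ p_ge5). Qed.

Lemma p_integralV2 : pint 2^-1.
Proof. by apply: (p_integralV_small 2); rewrite (leq_trans _ p_ge5). Qed.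

Lemma p_integral_harm2 (k : nat) : (k < p)%N -> pint (H2 k).
Proof.
move=> lt_kp; apply: p_integral_sum => j _; rewrite -exprVn.
by apply/p_integralX/p_integralV_small; rewrite /= (leq_ltn_trans _ lt_kp).
Qed.

(* The sum of [1/k^2] over [0 < k < p] is [2 H] by [k -> p - k], and [H/2] by
   separating even [k] from odd [k], so [3 H = 0]. *)
Lemma harm2_mod : cong 1 (H2 n) 0.
Proof.
pose f (k : nat) : rat := (k%:R ^+ 2)^-1.
have pf k : (0 < k < p)%N -> pint (f k).
  by move=> hk; rewrite /f -exprVn; apply/p_integralX/p_integralV_small.
have f0 k : (0 < k)%N -> k%:R ^+ 2 != 0 :> rat.
  by move=> k0; rewrite expf_neq0 // pnatr_eq0 -lt0n.
have fsym k : (0 < k < p)%N -> cong 1 (f (p - k)%N) (f k).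
  move=> hk; apply: pcongV; [apply: f0; lia|apply: f0; lia|apply: pf; lia|exact: pf|].
  exists (P - 2 * k%:R); last by rewrite natrB; [ring|lia].
  by pint_auto.
have H2E : H2 n = \sum_(i < n) f i.+1 by [].
have all1 : cong 1 (\sum_(i < 2 * n) f i.+1) (2 * H2 n).
  rewrite mul2n -addnn big_split_ord /= mulrDl mul1r H2E.
  apply: pcongD; first exact: pcong_refl.
  rewrite [X in cong _ _ X](reindex_inj rev_ord_inj) /=; apply: pcong_sum => i.
  have -> : (n + i).+1 = (p - (n - i.+1).+1)%N by have := ltn_ord i; lia.
  by apply: fsym; have := ltn_ord i; lia.
have f2 k : (0 < k)%N -> f (2 * k)%N = f k / 4.
  by move=> k0; rewrite /f natrM; field; rewrite ?pnatr_eq0; lia.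
have all2 : cong 1 (\sum_(i < 2 * n) f i.+1) (H2 n / 2).
  have -> m : \sum_(i < 2 * m) f i.+1
      = \sum_(i < m) f (2 * i).+1 + \sum_(i < m) f (2 * i.+1)%N.
    elim: m => [|m IHm]; first by rewrite !big_ord0 addr0.
    by rewrite mulnS !big_ord_recr /= IHm mulnS; ring.
  have -> : H2 n / 2 = \sum_(i < n) f i.+1 / 4 + \sum_(i < n) f i.+1 / 4.
    by rewrite -!mulr_suml -H2E; field.
  apply: pcongD.
    rewrite [X in cong _ _ X](reindex_inj rev_ord_inj) /=; apply: pcong_sum => i.
    (* Each odd number is [p] minus an even one, so the odd half is congruent to the even half. *)
    rewrite -f2 // (_ : (2 * i).+1 = (p - 2 * (n - i.+1).+1)%N); last first.
      by have := ltn_ord i; lia.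
    by apply: fsym; have := ltn_ord i; lia.
  by apply: pcong_sum => i; rewrite f2 //; apply: pcong_refl.
have [c pc Dc] := pcong_trans _ _ _ _ _ (pcong_sym _ _ _ _ all1) all2.
(* From [2H - H/2 = 3H/2]; 3 is invertible because [p >= 5]. *)
exists (2 * 3^-1 * c).
  have p3 : pint 3^-1 by apply: (p_integralV_small 3); rewrite (leq_trans _ p_ge5).
  by pint_auto.
by rewrite mulrCA -Dc; field.
Qed.

(** [(1 + t)(1 - t/2)^2 = 1 - 3/4 t^2 + t^3/4] has no linear term, so modulo [p^3] the product only
    collects squares. *)
Lemma ratio_prod_mod (k : nat) : (k < p)%N ->
  cong 3 (\prod_(j < k) ((1 + P / j.+1%:R) * (1 - P / (2 * j.+1%:R)) ^+ 2))
         (1 - 3 / 4 * P ^+ 2 * H2 k).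
Proof.
elim: k => [|k IHk] lt_kp.
  by rewrite big_ord0 /harm2 big_ord0 mulr0 subr0; apply: pcong_refl.
rewrite big_ord_recr /= /harm2 big_ord_recr -/(H2 k) /=.
have pk := p_integralV_small k.+1 lt_kp; have pP := p_integral_nat p p.
have pH : pint (H2 k) by apply: p_integral_harm2; lia.
have p4 := p_integralV4.
set x := (k.+1%:R)^-1 in pk *.
have -> : (1 + P * x) * (1 - P / (2 * k.+1%:R)) ^+ 2
    = 1 - 3 / 4 * (P * x) ^+ 2 + (P * x) ^+ 3 / 4.
  by rewrite /x; have k0 := ler0n rat k; field; nz.
apply: pcong_trans (pcongM _ _ _ _ _ _ _ _ (IHk (ltnW lt_kp)) (pcong_refl _ _ _)) _.
- by apply: (pcong_int p 3 _ _ (IHk (ltnW lt_kp))); pint_auto.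
- by pint_auto.
rewrite -exprVn -/x.
exists (x ^+ 3 / 4 * (1 - 3 / 4 * P ^+ 2 * H2 k) + 9 * 4^-1 * 4^-1 * P * H2 k * x ^+ 2).
  by pint_auto.
by field.
Qed.

(** Factor by factor, [(1 - t/2)^2 = (1 - t)(1 + t^2/4) + t^3/4]. Integrality of [P1] is carried
    through the induction. *)
Lemma half_prod_sqr_mod (k : nat) : (k < p)%N ->
  let P1 := \prod_(j < k) (1 - P / j.+1%:R) in
  pint P1 /\ cong 3 (\prod_(j < k) (1 - P / (2 * j.+1%:R)) ^+ 2)
                    (P1 * (1 + P ^+ 2 / 4 * H2 k)).
Proof.
elim: k => [|k IHk] lt_kp /=.
  rewrite !big_ord0 /harm2 big_ord0 mulr0 addr0 mulr1.
  by split; [apply: (p_integral_nat p 1)|apply: pcong_refl].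
have [] := IHk (ltnW lt_kp); rewrite !big_ord_recr /=.
set P1 := \prod_(_ < _) _; set P2 := \prod_(_ < _) _ => pP1 IH.
have -> : H2 k.+1 = H2 k + (k.+1%:R ^-1) ^+ 2 by rewrite /harm2 big_ord_recr /= exprVn.
have pk := p_integralV_small k.+1 lt_kp; have pP := p_integral_nat p p.
have pH : pint (H2 k) by apply: p_integral_harm2; lia.
have p2 := p_integralV2; have p4 := p_integralV4.
have -> : (1 - P / (2 * k.+1%:R)) ^+ 2 = (1 - P / k.+1%:R / 2) ^+ 2.
  by have k0 := ler0n rat k; field; nz.
move: pk; set x := (k.+1%:R)^-1 => px.
have pr1 : pint (P1 * (1 - P * x)) by pint_auto.
split => //; apply: pcong_trans (pcongM _ _ _ _ _ _ _ _ IH (pcong_refl _ _ _)) _.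
- by apply: (pcong_int p 3 _ _ IH); pint_auto.
- by pint_auto.
exists (P1 * x ^+ 2 / 4 * (P * H2 k / 4 + x)); last by field.
by pint_auto.
Qed.

Lemma cbin_neq0 : cbin rat n != 0.
Proof. exact/lt0r_neq0/cbin_gt0. Qed.

Lemma p_integralV_cbin : pint (cbin rat n)^-1.
Proof.
apply: p_integralV; rewrite coprime_sym prime_coprime //.
have n2 : (n <= 2 * n)%N by lia.
suff: ~~ (p %| (2 * n)`!)%N.
  by apply: contra => d; rewrite -(bin_fact n2) dvdn_mulr.
have: (2 * n < p)%N by lia.
elim: (2 * n)%N => [_|m IHm lt_mp]; first by rewrite dvdn1; lia.
rewrite factS Euclid_dvdM // negb_or IHm 1?ltnW // andbT.
by apply/negP => /dvdn_leq; lia.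
Qed.

(* [cbin n] is both [(-1)^n P(1)] and [(-4)^n P(1/2)] for
   [P(x) = prod_(j <= n) (1 - x p/j)], and [P(1/2)^2 = P(1)] modulo [p^3]. *)
Lemma morley : cong 3 (16 ^+ n / cbin rat n) ((-1) ^+ n).
Proof.
have lt_np : (n < p)%N by lia.
have [] := half_prod_sqr_mod n lt_np.
set P1 := \prod_(_ < _) _; set P2 := \prod_(_ < _) _ => pP1 h.
have e1 : cbin rat n = (-1) ^+ n * P1 by rewrite cbin_prod1 -Dp.
have e2 : cbin rat n ^+ 2 = 16 ^+ n * P2.
  rewrite {1}cbin_prod2 -Dp exprMn -exprM mulnC exprM /P2 prodrXl.
  by congr (_ ^+ _ * _); ring.
(* The correction [p^2/4 H_n] is a multiple of [p^3] by [harm2_mod]. *)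
have {h} h : cong 3 P2 P1.
  apply: pcong_trans h _; rewrite mulrDr mulr1 -[X in cong _ _ X]addr0.
  apply: pcongD; first exact: pcong_refl.
  have p4 := p_integralV4.
  have := pcongMl _ _ _ _ _ (p_integralM _ _ _ pP1 p4) (pcong_scale _ 1 2 _ _ harm2_mod).
  by rewrite !mulr0 (_ : _ * (_ * _) = P1 * (P ^+ 2 / 4 * H2 n)) //; ring.
(* The two sides become [(-1)^n 16^n / c_n^2] times [P1] and [P2]. *)
have e3 : 16 ^+ n / cbin rat n = 16 ^+ n * cbin rat n * (cbin rat n)^-1 ^+ 2.
  by field; exact: cbin_neq0.
have e4 : (-1) ^+ n = (-1) ^+ n * 16 ^+ n * P2 * (cbin rat n)^-1 ^+ 2.
  transitivity ((-1) ^+ n * (cbin rat n ^+ 2 * (cbin rat n)^-1 ^+ 2)).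
    by rewrite -exprMn mulfV ?cbin_neq0 // expr1n mulr1.
  by rewrite e2; ring.
rewrite e3 [X in cong _ _ X]e4 {1}e1.
rewrite (_ : _ * _ * _ = ((-1) ^+ n * 16 ^+ n * (cbin rat n)^-1 ^+ 2) * P1); last by ring.
rewrite [X in cong _ _ X](_ : _ =
  ((-1) ^+ n * 16 ^+ n * (cbin rat n)^-1 ^+ 2) * P2); last by ring.
apply: pcongMl; last exact: pcong_sym.
apply: p_integralM; last by apply/p_integralX/p_integralV_cbin.
apply: p_integralM; first by apply: p_integral_sign.
exact/p_integralX/(p_integral_nat p 16).
Qed.

Definition central_term (k : nat) : rat := cbin rat k * cbin rat (n - k) / cbin rat n.

(** Both sequences start at 1, and their ratios [x] and [y] of consecutive terms are congruent
    modulo [p]. *)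
Lemma central_term_mod (k : nat) : (k <= n)%N ->
  [/\ pint (central_term k), pint (legendre_term rat n k)
    & cong 1 (central_term k) (legendre_term rat n k)].
Proof.
have p1 := p_integral_nat p 1.
elim: k => [|k IHk] le_kn.
  have -> : central_term 0 = 1.
    by rewrite /central_term cbin0 mul1r subn0 mulfV ?cbin_neq0.
  have -> : legendre_term rat n 0 = 1 by rewrite /legendre_term !bin0 !mulr1.
  by split => //; apply: pcong_refl.
have [pv pl h] := IHk (ltnW le_kn).
have [i Dn] : exists i, n = (k + i).+1 by exists (n - k.+1)%N; lia.
have k0 := ler0n rat k; have i0 := ler0n rat i.
pose x := (2 * k.+1 - 1)%N%:R * i.+1%:R / k.+1%:R / (2 * i).+1%:R : rat.
pose y := - (i.+1%:R * (n + k).+1%:R / k.+1%:R / k.+1%:R) : rat.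
have -> : central_term k.+1 = central_term k * x.
  have cn := cbin_gt0 rat n; rewrite /central_term /x.
  have -> : (n - k = i.+1)%N by lia.
  have -> : (n - k.+1 = i)%N by lia.
  by rewrite !cbinS natrB //; field; nz.
have -> : legendre_term rat n k.+1 = legendre_term rat n k * y.
  have nk : n%:R - k%:R = i.+1%:R :> rat by rewrite Dn; ring.
  rewrite /legendre_term /y addnS bin_diagE bin_leftE nk exprS.
  by field; nz.
have pk1 : pint (k.+1%:R^-1) by apply: p_integralV_small; lia.
have pi1 : pint ((2 * i).+1%:R^-1) by apply: p_integralV_small; lia.
have px : pint x by rewrite /x; pint_auto.
have py : pint y by rewrite /y; pint_auto.
split; [exact: p_integralM|exact: p_integralM|].
(* The witness comes from [(2k+1)(k+1) + (n+k+1)(2i+1) = n p]. *)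
apply: pcongM => //; exists (n%:R * i.+1%:R / k.+1%:R / k.+1%:R / (2 * i).+1%:R).
  by pint_auto.
rewrite /x /y Dp Dn natrB //; field; nz.
Qed.

Lemma fermat_pcong (k : nat) : (0 < k < p)%N -> cong 1 (k%:R ^+ p.-1) 1.
Proof.
move=> hk; rewrite -natrX; apply: (pcong_mod p _ 1).
have := cyclic.Euler_exp_totient (coprime_small _ _ pr_p hk).
by rewrite totient_prime.
Qed.

(** By Fermat, [1/k^2] is congruent to [4 (2k)^(p-3)]; the resulting power sum is, up to a factor,
    the value of [euler_poly (p - 3)] at [2n + 1 = p]. *)
Lemma alternating_sum_mod :
  cong 1 (\sum_(k < n) (-1) ^+ k.+1 / k.+1%:R ^+ 2)
         (2 * (-1) ^+ n * euler_number (p - 3)).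
Proof.
have psgn := p_integral_sign p.
have even_m : ~~ odd (p - 3) by rewrite Dp; lia.
have m_gt0 : (0 < p - 3)%N by lia.
have Dm : p.-1 = (p - 3 + 2)%N by lia.
have := alternating_power_sum _ n even_m m_gt0; rewrite -Dp => e.
have h : cong 1 (2 * ((-1) ^+ n * euler_poly (p - 3) P))
                (2 * (-1) ^+ n * euler_number (p - 3)).
  rewrite -mulrA; apply: pcongMl; first exact: (p_integral_nat p 2).
  by apply: pcongMl => //; apply: euler_poly_mod.
apply: pcong_trans h; rewrite -e !mulr_sumr; apply: pcong_sum => k.
have hk : (0 < k.+1 < p)%N by have := ltn_ord k; lia.
have h2 : (0 < 2 < p)%N by lia.
have k0 := ler0n rat k.
have -> : 2 * (2 * ((-1) ^+ k.+1 * (2 * k.+1%:R) ^+ (p - 3)))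
   = (-1) ^+ k.+1 / k.+1%:R ^+ 2 * (2 ^+ p.-1 * k.+1%:R ^+ p.-1) :> rat.
  by rewrite Dm !exprD exprMn; field; nz.
rewrite -[X in cong _ X _]mulr1 -[X in cong _ (_ * X) _](mulr1 1).
apply: pcongMl.
  by apply: p_integralM => //; rewrite -exprVn; apply/p_integralX/p_integralV_small.
apply: pcong_sym; apply: pcongM; [exact/p_integralX/(p_integral_nat p 2)
  |exact: (p_integral_nat p 1)|exact: (fermat_pcong 2)|exact: fermat_pcong].
Qed.

Lemma central_term_harm2_mod :
  cong 1 (4 ^+ n * \sum_(k < n.+1) central_term k * H2 k) (-4 * euler_number (p - 3)).
Proof.
have psgn := p_integral_sign p.
have pH k : (k <= n)%N -> pint (H2 k) by move=> le_kn; apply: p_integral_harm2; lia.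
apply: (@pcong_trans _ _ _ (1 * \sum_(k < n.+1) legendre_term rat n k * H2 k)).
  apply: pcongM.
  - exact/p_integralX/(p_integral_nat p 4).
  - apply: p_integral_sum => k _; have le_kn : (k <= n)%N by rewrite -ltnS.
    by have [_ pl _] := central_term_mod _ le_kn; apply: p_integralM => //; apply: pH.
  (* [4^n = 2^(p-1)] is 1 modulo [p]. *)
  - rewrite (_ : 4 ^+ n = 2%:R ^+ p.-1) ?Dp /=; last first.
      by rewrite exprM; congr (_ ^+ _); ring.
    by have := fermat_pcong 2; rewrite Dp /=; apply; lia.
  apply: pcong_sum => k; have le_kn : (k <= n)%N by rewrite -ltnS.
  have [pv _ h] := central_term_mod _ le_kn.
  by apply: pcongM => //; [apply: pH|apply: pcong_refl].
rewrite mul1r legendre_harm2.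
have s1 : (-1) ^+ n * (-1) ^+ n = 1 :> rat by rewrite -expr2 sqrr_sign.
have -> : -4 * euler_number (p - 3)
   = -2 * (-1) ^+ n * (2 * (-1) ^+ n * euler_number (p - 3)).
  transitivity (-4 * ((-1) ^+ n * (-1) ^+ n) * euler_number (p - 3)); last by ring.
  by rewrite s1; ring.
apply: pcongMl; last exact: alternating_sum_mod.
by apply: p_integralM => //; apply: (p_integral_int p (-2)).
Qed.

Lemma hyper_sum_mod :
  cong 3 (4 ^+ n * \sum_(k < n.+1) central_term k
       * \prod_(j < k) ((1 + P / j.+1%:R) * (1 - P / (2 * j.+1%:R)) ^+ 2))
    ((-1) ^+ n + 3 * P ^+ 2 * euler_number (p - 3)).
Proof.
have p4 := p_integralV4.
have h : cong 3 (\sum_(k < n.+1) central_term k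
       * \prod_(j < k) ((1 + P / j.+1%:R) * (1 - P / (2 * j.+1%:R)) ^+ 2))
   (\sum_(k < n.+1) central_term k * (1 - 3 / 4 * P ^+ 2 * H2 k)).
  apply: pcong_sum => k; have le_kn : (k <= n)%N by rewrite -ltnS.
  have [pv _ _] := central_term_mod _ le_kn.
  by apply: pcongMl => //; apply: ratio_prod_mod; lia.
have p4n : pint (4 ^+ n) by apply/p_integralX/(p_integral_nat p 4).
apply: pcong_trans (pcongMl _ _ _ _ _ p4n h) _.
have -> : 4 ^+ n * \sum_(k < n.+1) central_term k * (1 - 3 / 4 * P ^+ 2 * H2 k)
  = 16 ^+ n / cbin rat n
    + - (3 / 4) * (P ^+ 2 * (4 ^+ n * \sum_(k < n.+1) central_term k * H2 k)).
  have -> : 16 ^+ n / cbin rat n = 4 ^+ n * \sum_(k < n.+1) central_term k.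
    rewrite -mulr_suml cbin_conv mulrA -exprMn; congr (_ ^+ _ * _); ring.
  rewrite !mulr_sumr -big_split; apply: eq_bigr => k _ /=; ring.
apply: pcongD; first exact: morley.
rewrite (_ : 3 * _ * _ = - (3 / 4) * (P ^+ 2 * (-4 * euler_number (p - 3)))).
  2: by field.
apply: pcongMl; first by apply/p_integralN/p_integralM => //; apply: (p_integral_nat p 3).
(* The harmonic sum carries a factor [p^2], so its value modulo [p] suffices. *)
exact: (pcong_scale _ 1 2 _ _ central_term_harm2_mod).
Qed.

End Modp.

Theorem theorem1p2 (p : nat) (hp : prime p) (hp5 : (5 <= p)%N) :
  p_integral_eqmod p (p ^ 4)
    (\sum_(k < p) (3 * k + 2)%N%:R / (-2) ^+ k * (Domb k)%:R)
    (2 * p%:R * (-1) ^+ ((p - 1) %/ 2)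
       + 6 * p%:R ^+ 3 * euler_number (p - 3)).
Proof.
have Dp : p = (2 * ((p - 1) %/ 2)).+1.
  by case: (even_prime hp) => [|odd_p]; lia.
set n := ((p - 1) %/ 2)%N in Dp *.
have [c pc Dc] := hyper_sum_mod p n hp hp5 Dp.
have pE := euler_number_int p (p - 3).
have pRHS : p_integral p (2 * p%:R * (-1) ^+ n + 6 * p%:R ^+ 3 * euler_number (p - 3)).
  by have psgn := p_integral_sign p n; pint_auto.
have D : \sum_(k < p) (3 * k + 2)%N%:R / (-2) ^+ k * (Domb k)%:R
   - (2 * p%:R * (-1) ^+ n + 6 * p%:R ^+ 3 * euler_number (p - 3)) = (p ^ 4)%:R * (2 * c).
  rewrite weighted_Domb_sum.
  have -> : \sum_(k < p) (p%:R - 2 * k%:R) * 'C(p + k, 3 * k)%:R * alt_weight rat k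
     = p%:R * \sum_(k < n.+1) central_term n k
       * \prod_(j < k) ((1 + p%:R / j.+1%:R) * (1 - p%:R / (2 * j.+1%:R)) ^+ 2).
    rewrite -(big_mkord xpredT (fun k =>
      (p%:R - 2 * k%:R) * 'C(p + k, 3 * k)%:R * alt_weight rat k)).
    rewrite (big_cat_nat (n := n.+1)) //=; last by lia.
    (* For [k > n] one has [3k > p + k], and the binomial coefficient vanishes. *)
    rewrite [X in _ + X]big_nat [X in _ + X]big1 ?addr0; last first.
      by move=> k /andP[lt_nk _]; rewrite bin_small ?mulr0 ?mul0r //; lia.
    rewrite big_mkord mulr_sumr; apply: eq_bigr => k _.
    have le_kn : (k <= n)%N by rewrite -ltnS.
    by rewrite (hyper_term _ p n k le_kn Dp) -mulrA.
  have -> : - (-2) ^+ p = 2 * 4 ^+ n :> rat.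
    rewrite {1}Dp exprS exprM (_ : (-2) ^+ 2 = 4); ring.
  (* The factor [p] drawn out of the sum lifts the congruence from [p^3] to [p^4]. *)
  transitivity (2 * p%:R * (p%:R ^+ 3 * c)); last by rewrite natrX; ring.
  by rewrite -Dc; ring.
split => //.
  rewrite -[X in p_integral _ X](subrK (2 * p%:R * (-1) ^+ n
    + 6 * p%:R ^+ 3 * euler_number (p - 3))) D.
  by apply: p_integralD pRHS; pint_auto.
by exists (2 * c); split; [pint_auto|exact: D].
Qed.
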